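(* Let $u$ be the mild solution of the one-dimensional stochastic wave equation defined in the context, and for $N\in\mathbb N$, $i\in\{0,\dots,N-1\}$, $t>0$ put $u(t,A_i)=u(t,\frac{i+1}N)-u(t,\frac iN)$. (a) Suppose $t_1,t_2>0$, $t_1\ne t_2$ and $t_1+t_2>1$. Then for all $N\in\mathbb N$ and $i,j\in\{0,\dots,N-1\}$ with $i\ne j$, $$\begin{aligned}\mathbf E[u(t_1,A_i)u(t_2,A_j)]=&-\frac1{8N^2}1_{\{|t_1-t_2|\le\frac{|i-j|-1}N\}}+f^{(1)}_{t_1,t_2,N}(|i-j|)\,1_{\{\frac{|i-j|-1}N<|t_1-t_2|\le\frac{|i-j|}N\}}\\&+f^{(2)}_{t_1,t_2,N}(|i-j|)\,1_{\{\frac{|i-j|}N<|t_1-t_2|\le\frac{|i-j|+1}N\}},\end{aligned}$$ where, for $1\le k\le N$, $$f^{(1)}_{t_1,t_2,N}(k)=\frac2{16}\Big(t_1+t_2-\frac kN\Big)^2-\frac1{16}\Big(t_1+t_2-\frac{k+1}N\Big)^2-\frac14(t_1\wedge t_2)^2,$$ $$f^{(2)}_{t_1,t_2,N}(k)=\frac14(t_1\wedge t_2)^2-\frac1{16}\Big(t_1+t_2-\frac{k+1}N\Big)^2.$$ (b) Suppose $t_1,t_2>0$, $t_1\ne t_2$ and $t_1+t_2>1$. Then $\mathbf E[u(t_1,A_i)u(t_2,A_i)]=0$ for every $N\in\mathbb N$ with $N>|t_1-t_2|^{-1}$ and every $i\in\{0,\dots,N-1\}$. (c) Suppose $t>\frac12$.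 Then $\mathbf E[u(t,A_i)^2]=\frac1{4N}2t-\frac1{8N^2}=\frac1{4N}\big(2t-\frac1{2N}\big)$ for every $N\in\mathbb N$ and $i\in\{0,\dots,N-1\}$. (d) Suppose $t>\frac12$. Then $\mathbf E[u(t,A_i)u(t,A_j)]=-\frac1{8N^2}$ for every $N\in\mathbb N$ and all $i,j\in\{0,\dots,N-1\}$ with $i\ne j$.
   Context: $W=\{W_t(A)\}$, $t\ge0$, $A\subset\mathbb R$ Borel of finite Lebesgue measure, is a centered Gaussian field (space-time white noise) with $\mathbf E[W_t(A)W_s(B)]=(t\wedge s)\lambda(A\cap B)$, $\lambda$ being Lebesgue measure on $\mathbb R$. The mild solution of $\partial_t^2u=\Delta u+\dot W$ on $(0,\infty)\times\mathbb R$ with $u(0,\cdot)=\partial_tu(0,\cdot)=0$ is the Gaussian process $u(t,x)=\int_0^t\int_{\mathbb R}G_1(t-s,x-y)\,W(ds,dy)$ (Wiener integral), with $G_1(t,x)=\frac12 1_{\{|x|<t\}}$. Here $A_i=[\frac iN,\frac{i+1}N]$ and $a\wedge b=\min(a,b)$. *)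

(* Defs.v *)
From HB Require Import structures.
From mathcomp Require Import all_boot all_order all_algebra.
From mathcomp Require Import all_classical all_reals all_analysis.

Set Implicit Arguments.
Unset Strict Implicit.
Unset Printing Implicit Defensive.

Import Order.TTheory GRing.Theory Num.Theory.
Import numFieldNormedType.Exports.

Local Open Scope classical_set_scope.
Local Open Scope ring_scope.

Section WhiteNoise.
Context (R : realType) (d : measure_display) (T : measurableType d)
  (P : probability T R).

Local Notation lambda := (@lebesgue_measure R).

(* Zero variance is treated apart because [normal_prob m 0] is the uniform
   distribution on [0, 1], not the Dirac mass at [m]. *)
Definition centered_gaussian (Y : T -> R) : Prop :=
  exists sigma : R, 0 <= sigma /\
    forall B : set (measurableTypeR R), measurable B ->
      pushforward P Y B =
        if sigma == 0 then \d_(0 : measurableTypeR R) B else normal_prob 0 sigma B.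

Definition finite_borel (A : set (measurableTypeR R)) : Prop :=
  measurable A /\ (lambda A < +oo)%E.

(* [W] is total; its values are only constrained for [0 <= t] and Borel [A] of
   finite measure. *)
Definition white_noise
    (W : R -> set (measurableTypeR R) -> {RV P >-> R}) : Prop :=
  [/\ forall (n : nat) (t : 'I_n -> R) (A : 'I_n -> set (measurableTypeR R))
        (c : 'I_n -> R),
        (forall i, 0 <= t i) -> (forall i, finite_borel (A i)) ->
        centered_gaussian (fun w => \sum_(i < n) c i * W (t i) (A i) w) &
      forall (t s : R) (A B : set (measurableTypeR R)),
        0 <= t -> 0 <= s -> finite_borel A -> finite_borel B ->
        ('E_P[fun w => (W t A w * W s B w)%R] =
         (Num.min t s)%:E * lambda (A `&` B))%E].

Record step := Step {
  step_coef : R; step_inf : R; step_sup : R; step_base : set (measurableTypeR R) }.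

Definition step_wf (e : step) : Prop :=
  [/\ 0 <= step_inf e, step_inf e <= step_sup e & finite_borel (step_base e)].

Definition step_fun (e : step) (p : measurableTypeR R * measurableTypeR R) : R :=
  step_coef e * \1_(`]step_inf e, step_sup e] `*` step_base e) p.

Definition step_int (W : R -> set (measurableTypeR R) -> {RV P >-> R})
    (e : step) (w : T) : R :=
  step_coef e * (W (step_sup e) (step_base e) w - W (step_inf e) (step_base e) w).

(* [X] is a version of the Wiener integral of [h]: the L^2(P) limit of the
   integrals of finite sums of elementary integrands converging to [h] in L^2.
   Integrands on [0, +oo[ x R are extended by 0 to R x R. *)
Definition wiener_integral (W : R -> set (measurableTypeR R) -> {RV P >-> R})
    (h : measurableTypeR R * measurableTypeR R -> R) (X : {RV P >-> R}) : Prop :=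
  h \in Lfun (lambda \x lambda)%E 2%:E /\
  exists (m : nat -> nat) (e : forall n, 'I_(m n) -> step),
    [/\ forall n i, step_wf (e n i),
        'N[(lambda \x lambda)%E]_2%:E
          [EFin \o (fun p => (h p - \sum_(i < m n) step_fun (e n i) p)%R)]%E
          @[n --> \oo] --> 0%E &
        'N[P]_2%:E
          [EFin \o (fun w => (X w - \sum_(i < m n) step_int W (e n i) w)%R)]%E
          @[n --> \oo] --> 0%E].

Definition G1 (t x : R) : R := 2^-1 * (`|x| < t)%R%:R.

(* The solution is determined up to modification, so [u] is any process each of
   whose values is a version of the corresponding Wiener integral. *)
Definition mild_solution (W : R -> set (measurableTypeR R) -> {RV P >-> R})
    (u : R -> R -> {RV P >-> R}) : Prop :=
  forall t x : R, 0 <= t ->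
    wiener_integral W
      (fun p => \1_`[0, t] p.1 * G1 (t - p.1) (x - p.2)) (u t x).

Definition increment (u : R -> R -> {RV P >-> R}) (N : nat) (t : R) (i : nat)
    (w : T) : R :=
  u t (i.+1%:R / N%:R) w - u t (i%:R / N%:R) w.

End WhiteNoise.

Definition f1 (R : realType) (t1 t2 : R) (N k : nat) : R :=
  2 / 16 * (t1 + t2 - k%:R / N%:R) ^+ 2
  - 1 / 16 * (t1 + t2 - k.+1%:R / N%:R) ^+ 2
  - 1 / 4 * (Num.min t1 t2) ^+ 2.

Definition f2 (R : realType) (t1 t2 : R) (N k : nat) : R :=
  1 / 4 * (Num.min t1 t2) ^+ 2 - 1 / 16 * (t1 + t2 - k.+1%:R / N%:R) ^+ 2.

(* Main.v *)
(* The Wiener integral is an L^2 limit of integrals of step functions, on which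
   the white noise covariance is the L^2 inner product; by continuity of inner
   products, E[u(t,x) u(s,y)] is the inner product of the two wave kernels.  At
   time r the backward light cones of (t,x) and (s,y) meet in an interval of
   length 2 (c - r)^+, where c = min(t, s, (t + s - |x - y|) / 2), so for
   |x - y| < t + s this covariance is c^2 / 4.  It equals min(t, s)^2 / 4 when
   |x - y| <= |t - s| and (t + s - |x - y|)^2 / 16 otherwise; the covariance of
   two increments is minus a second difference in |x - y| of this function. *)

Require Import Defs.
From HB Require Import structures.
From mathcomp Require Import all_boot all_order all_algebra.
From mathcomp Require Import all_classical all_reals all_analysis.
From mathcomp Require Import measurable_realfun ring lra.

Set Implicit Arguments.
Unset Strict Implicit.
Unset Printing Implicit Defensive.

Import Order.TTheory GRing.Theory Num.Theory.
Import numFieldNormedType.Exports.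

Local Open Scope classical_set_scope.
Local Open Scope ring_scope.

(** * The inner product of L^2 and its continuity *)

Section L2Inner.
Context d (T : measurableType d) (R : realType).
Variable mu : {measure set T -> \bar R}.
Implicit Types f g : T -> R.

Definition inner f g : R := \int[mu]_x (f x * g x).

Lemma inner_integrable f g : f \in Lfun mu 2%:E -> g \in Lfun mu 2%:E ->
  mu.-integrable setT (EFin \o (fun x => f x * g x)).
Proof. by move=> hf hg; apply/Lfun1_integrable; exact: Lfun2_mul_Lfun1. Qed.

Lemma innerC f g : inner f g = inner g f.
Proof. by rewrite /inner; under eq_Rintegral do rewrite mulrC. Qed.

Lemma innerDl f1 f2 g : f1 \in Lfun mu 2%:E -> f2 \in Lfun mu 2%:E ->
  g \in Lfun mu 2%:E ->
  inner (fun x => f1 x + f2 x) g = inner f1 g + inner f2 g.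
Proof.
move=> h1 h2 hg; rewrite /inner -RintegralD//; try exact: inner_integrable.
by under eq_Rintegral do rewrite mulrDl.
Qed.

Lemma innerZl a f g : f \in Lfun mu 2%:E -> g \in Lfun mu 2%:E ->
  inner (fun x => a * f x) g = a * inner f g.
Proof.
move=> hf hg; rewrite /inner -RintegralZl//; last exact: inner_integrable.
by under eq_Rintegral do rewrite -mulrA.
Qed.

Lemma Lfun2D f g : f \in Lfun mu 2%:E -> g \in Lfun mu 2%:E ->
  (fun x => f x + g x) \in Lfun mu 2%:E.
Proof.
have [_ addc] := Lfun_addr_closed mu (lee1n 2 : (1 <= 2%:E :> \bar R)%E).
exact: addc.
Qed.

Lemma Lfun2Z a f : f \in Lfun mu 2%:E -> (fun x => a * f x) \in Lfun mu 2%:E.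
Proof.
move=> hf; have := @Lfun_scale _ _ _ mu f a 2 _ hf.
rewrite (_ : (fun x => a * f x) = a \o* f); first by apply; rewrite ler1n.
by apply/funext => x /=; rewrite mulrC.
Qed.

Lemma Lfun2B f g : f \in Lfun mu 2%:E -> g \in Lfun mu 2%:E ->
  (fun x => f x - g x) \in Lfun mu 2%:E.
Proof.
move=> hf hg; rewrite (_ : (fun x => _) = (fun x => f x + (-1) * g x)).
  by apply: Lfun2D => //; exact: Lfun2Z.
by apply/funext => x; rewrite mulN1r.
Qed.

Lemma innerBl f1 f2 g : f1 \in Lfun mu 2%:E -> f2 \in Lfun mu 2%:E ->
  g \in Lfun mu 2%:E ->
  inner (fun x => f1 x - f2 x) g = inner f1 g - inner f2 g.
Proof.
move=> h1 h2 hg; rewrite /inner -RintegralB//; try exact: inner_integrable.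
by under eq_Rintegral do rewrite mulrBl.
Qed.

Lemma innerBr f g1 g2 : f \in Lfun mu 2%:E -> g1 \in Lfun mu 2%:E ->
  g2 \in Lfun mu 2%:E ->
  inner f (fun x => g1 x - g2 x) = inner f g1 - inner f g2.
Proof. by move=> h1 h2 hg; rewrite innerC innerBl// !(innerC f). Qed.

Lemma innerZr a f g : f \in Lfun mu 2%:E -> g \in Lfun mu 2%:E ->
  inner f (fun x => a * g x) = a * inner f g.
Proof. by move=> hf hg; rewrite innerC innerZl// innerC. Qed.

Lemma Lfun_cst0 : cst (0 : R) \in Lfun mu 2%:E.
Proof. by have [] := Lfun_addr_closed mu (lee1n 2 : (1 <= 2%:E :> \bar R)%E). Qed.

Lemma Lfun2_sum (I : Type) (r : seq I) (F : I -> T -> R) :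
  (forall i, F i \in Lfun mu 2%:E) ->
  (fun x => \sum_(i <- r) F i x) \in Lfun mu 2%:E.
Proof.
move=> hF; elim: r => [|i r IH].
  rewrite (_ : (fun x => _) = cst 0); last by apply/funext => x; rewrite big_nil.
  exact: Lfun_cst0.
rewrite (_ : (fun x => _) = fun x => F i x + \sum_(j <- r) F j x).
  exact: Lfun2D.
by apply/funext => x; rewrite big_cons.
Qed.

Lemma inner_suml (I : Type) (r : seq I) (F : I -> T -> R) g :
  (forall i, F i \in Lfun mu 2%:E) -> g \in Lfun mu 2%:E ->
  inner (fun x => \sum_(i <- r) F i x) g = \sum_(i <- r) inner (F i) g.
Proof.
move=> hF hg; elim: r => [|i r IH].
  rewrite big_nil /inner; under eq_Rintegral do rewrite big_nil mul0r.
  by rewrite Rintegral_cst// mul0r.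
rewrite big_cons -IH -innerDl//; last exact: Lfun2_sum.
by rewrite /inner; under eq_Rintegral do rewrite big_cons.
Qed.

Lemma inner_sumr (I : Type) (r : seq I) (F : I -> T -> R) g :
  (forall i, F i \in Lfun mu 2%:E) -> g \in Lfun mu 2%:E ->
  inner g (fun x => \sum_(i <- r) F i x) = \sum_(i <- r) inner g (F i).
Proof.
by move=> hF hg; rewrite innerC inner_suml//; under eq_bigr do rewrite innerC.
Qed.

(** As [fine] sends an infinite norm to 0, this is the true norm only on [Lfun mu 2%:E]. *)
Definition L2norm f : R := fine 'N[mu]_2%:E[EFin \o f]%E.

Lemma Lfun2_measurable f : f \in Lfun mu 2%:E -> measurable_fun setT f.
Proof. by rewrite inE => /andP[/[!inE]]. Qed.

Lemma L2normE f : f \in Lfun mu 2%:E ->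
  ('N[mu]_2%:E[EFin \o f] = (L2norm f)%:E)%E.
Proof.
rewrite inE => /andP[_ /[!inE]/= hf].
by rewrite /L2norm fineK// ge0_fin_numE// Lnorm_ge0.
Qed.

(** Cauchy-Schwarz, as Hölder's inequality with both exponents equal to 2. *)
Lemma inner_le f g : f \in Lfun mu 2%:E -> g \in Lfun mu 2%:E ->
  `|inner f g| <= L2norm f * L2norm g.
Proof.
move=> hf hg; rewrite -lee_fin EFin_normr_Rintegral//; last exact: inner_integrable.
apply: (le_trans (le_abse_integral _ _ _)) => //.
  by have /integrableP[] := inner_integrable hf hg.
have := @hoelder _ _ _ mu f g 2 2 (Lfun2_measurable hf) (Lfun2_measurable hg).
rewrite Lnorm1 EFinM -!L2normE//; apply => //.
by rewrite [RHS]splitr !div1r.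
Qed.

Lemma L2norm_cvg0 (e : nat -> T -> R) :
  ('N[mu]_2%:E[EFin \o e n]%E @[n --> \oo] --> 0%E) ->
  L2norm (e n) @[n --> \oo] --> (0 : R).
Proof. by move=> /fine_cvg. Qed.

Lemma cvg_inner f g (f_ g_ : nat -> T -> R) :
  f \in Lfun mu 2%:E -> g \in Lfun mu 2%:E ->
  (forall n, f_ n \in Lfun mu 2%:E) -> (forall n, g_ n \in Lfun mu 2%:E) ->
  'N[mu]_2%:E[EFin \o (fun x => (f x - f_ n x)%R)]%E @[n --> \oo] --> 0%E ->
  'N[mu]_2%:E[EFin \o (fun x => (g x - g_ n x)%R)]%E @[n --> \oo] --> 0%E ->
  inner (f_ n) (g_ n) @[n --> \oo] --> inner f g.
Proof.
move=> hf hg hf_ hg_ cf cg.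
pose e n x := f x - f_ n x; pose e' n x := g x - g_ n x.
have he n : e n \in Lfun mu 2%:E by exact: Lfun2B.
have he' n : e' n \in Lfun mu 2%:E by exact: Lfun2B.
have ce : L2norm (e n) @[n --> \oo] --> (0 : R) by exact: L2norm_cvg0.
have ce' : L2norm (e' n) @[n --> \oo] --> (0 : R) by exact: L2norm_cvg0.
have to0 (a b : nat -> T -> R) : (forall n, a n \in Lfun mu 2%:E) ->
    (forall n, b n \in Lfun mu 2%:E) ->
    L2norm (a n) * L2norm (b n) @[n --> \oo] --> (0 : R) ->
    inner (a n) (b n) @[n --> \oo] --> (0 : R).
  move=> ha hb hab; apply/norm_cvg0P.
  apply: (@squeeze_cvgr _ _ _ _ (cst 0) (fun n => L2norm (a n) * L2norm (b n))).
  - by apply: nearW => n /=; rewrite normr_ge0 inner_le.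
  - exact: cvg_cst.
  - exact: hab.
(* Bilinear expansion with [f_ n = f - e n] and [g_ n = g - e' n]: each term other than [inner f g]
   contains an error, so Cauchy-Schwarz sends it to 0. *)
have -> : (fun n => inner (f_ n) (g_ n)) =
    (fun n => inner f g - (inner (e n) g + inner f (e' n) - inner (e n) (e' n))).
  apply/funext => n.
  rewrite (@innerBl f (f_ n) g)// (@innerBr f g (g_ n))//.
  rewrite (@innerBl f (f_ n) (e' n))// !innerBr//.
  by ring.
(* The limit is written as [inner f g - (0 + 0 - 0)], to match the expansion term by term. *)
rewrite -[X in _ --> X]subr0 -[X in _ - X](subr0 (0 : R)) -[X in _ - (X - _)](addr0 (0 : R)).
apply: cvgB; first exact: cvg_cst.
apply: cvgB; [apply: cvgD|].
- apply: (to0 e (fun=> g)) => //; rewrite -(mul0r (L2norm g)).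
  by apply: cvgM => //; exact: cvg_cst.
- apply: (to0 (fun=> f) e') => //; rewrite -(mulr0 (L2norm f)).
  by apply: cvgM => //; exact: cvg_cst.
- by apply: to0 => //; rewrite -(mulr0 0); exact: cvgM.
Qed.

End L2Inner.

(** * Square integrability and indicators *)

Section SquareIntegrable.
Context d (T : measurableType d) (R : realType).
Variable mu : {measure set T -> \bar R}.

Lemma Lfun2_sqr_lty (f : T -> R) : measurable_fun setT f ->
  (\int[mu]_x (f x ^+ 2)%:E < +oo)%E -> f \in Lfun mu 2%:E.
Proof.
move=> mf foo; rewrite inE; apply/andP; split; first by rewrite inE.
rewrite inE/= /finite_norm unlock; apply: poweR_lty; apply: le_lt_trans foo.
rewrite le_eqVlt; apply/orP; left; apply/eqP; apply: eq_integral => x _ /=.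
by rewrite powR_mulrn// real_normK// num_real.
Qed.

Lemma Lfun2_indic (A : set T) : measurable A -> (mu A < +oo)%E ->
  (\1_A : T -> R) \in Lfun mu 2%:E.
Proof.
move=> mA Aoo; apply: Lfun2_sqr_lty => //.
under eq_integral => x _ do
  rewrite expr2 -[_ * _]/((\1_A \* \1_A) x) -indicI setIid.
by rewrite integral_indic// setIT.
Qed.

Lemma inner_indic (A B : set T) : measurable A -> measurable B ->
  inner mu \1_A \1_B = fine (mu (A `&` B)).
Proof.
move=> mA mB; rewrite /inner /Rintegral.
under eq_integral => x _ do
  rewrite -[_ * _]/((\1_A \* \1_B) x) -indicI.
by rewrite integral_indic ?setIT//; exact: measurableI.
Qed.

End SquareIntegrable.

(** The length appears as a mixed second difference of [Num.min] because that is what the time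
    covariance min(t, s) of the noise produces when a product of two time increments is expanded. *)
Lemma lebesgue_measure_ocitvI (R : realType) (a1 b1 a2 b2 : R) : a1 <= b1 -> a2 <= b2 ->
  lebesgue_measure ((`]a1, b1] : set (measurableTypeR R)) `&` `]a2, b2]) =
  (Num.min b1 b2 - Num.min a1 b2 - Num.min b1 a2 + Num.min a1 a2)%:E.
Proof.
move=> ab1 ab2.
have -> : `]a1, b1] `&` `]a2, b2] = [set` `]Num.max a1 a2, Num.min b1 b2]].
  apply/seteqP; split => x /=; rewrite !in_itv/= gt_max le_min.
    by move=> [/andP[-> ->] /andP[-> ->]].
  by move=> /andP[/andP[-> ->] /andP[-> ->]].
rewrite lebesgue_measure_itv/= lte_fin -EFinB.
case: ltP; rewrite /Num.max /Num.min; repeat case: ifP; move=> *; congr (_%:E); lra.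
Qed.

(** * The isometry of the Wiener integral *)

Section WienerIsometry.
Context (R : realType) (d : measure_display) (T : measurableType d)
  (P : probability T R) (W : R -> set (measurableTypeR R) -> {RV P >-> R}).
Hypothesis hW : white_noise W.

Local Notation lambda := (@lebesgue_measure R).
Local Notation lambda2 := (lambda \x lambda)%E.

Lemma white_noise_Lfun2 t A : 0 <= t -> finite_borel A ->
  (W t A : T -> R) \in Lfun P 2%:E.
Proof.
move=> t0 fA; apply: Lfun2_sqr_lty => //.
have [_ /(_ t t A A t0 t0 fA fA)] := hW; rewrite unlock minxx setIid.
move=> E; under eq_integral => x _ do rewrite expr2.
rewrite E; case: fA => _ Aoo.
by rewrite lte_mul_pinfty ?lee_fin// ltry.
Qed.

Lemma inner_white_noise t s A B : 0 <= t -> 0 <= s ->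
  finite_borel A -> finite_borel B ->
  inner P (W t A) (W s B) = Num.min t s * fine (lambda (A `&` B)).
Proof.
move=> t0 s0 fA fB; have [_ /(_ t s A B t0 s0 fA fB)] := hW.
rewrite unlock /inner /Rintegral => ->; rewrite fineM// ge0_fin_numE//.
case: fA fB => mA Aoo [mB Boo]; apply: le_lt_trans Aoo.
by apply: le_measure; rewrite ?inE//; exact: measurableI.
Qed.

Lemma step_int_Lfun2 e : step_wf e -> step_int W e \in Lfun P 2%:E.
Proof.
move=> [a0 ab fB]; apply: Lfun2Z; apply: Lfun2B; apply: white_noise_Lfun2 => //.
exact: le_trans ab.
Qed.

Let step_set (e : step R) : set (measurableTypeR R * measurableTypeR R) :=
  `]step_inf e, step_sup e] `*` step_base e.

Let step_set_measurable e : step_wf e -> measurable (step_set e).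
Proof. by move=> [_ _ [mB _]]; exact: measurableX. Qed.

Let step_set_lty e : step_wf e -> (lambda2 (step_set e) < +oo)%E.
Proof.
move=> [a0 ab [mB Boo]]; rewrite /step_set product_measure1E//=.
rewrite lte_mul_pinfty//.
by rewrite lebesgue_measure_itv/=; case: ifP.
Qed.

Let step_set_Lfun2 e : step_wf e -> \1_(step_set e) \in Lfun lambda2 2%:E.
Proof.
by move=> we; apply: Lfun2_indic; [exact: step_set_measurable|exact: step_set_lty].
Qed.

Lemma step_fun_Lfun2 e : step_wf e -> step_fun e \in Lfun lambda2 2%:E.
Proof. by move=> we; apply: Lfun2Z; exact: step_set_Lfun2. Qed.

Let step_setI_measure e e' : step_wf e -> step_wf e' ->
  lambda2 (step_set e `&` step_set e') =
  (lambda ((`]step_inf e, step_sup e] : set (measurableTypeR R)) `&`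
           `]step_inf e', step_sup e'])
   * lambda (step_base e `&` step_base e'))%E.
Proof.
move=> [_ _ [mB _]] [_ _ [mB' _]].
have -> : step_set e `&` step_set e' =
    ((`]step_inf e, step_sup e] : set (measurableTypeR R)) `&`
      `]step_inf e', step_sup e']) `*` (step_base e `&` step_base e').
  by rewrite /step_set setXI.
by rewrite product_measure1E//; exact: measurableI.
Qed.

(** Both sides factor into a time part and a space part. The space part is the measure of the
    intersection of the bases; the time parts agree by [lebesgue_measure_ocitvI]. *)
Lemma inner_step e e' : step_wf e -> step_wf e' ->
  inner P (step_int W e) (step_int W e') =
  inner lambda2 (step_fun e) (step_fun e').
Proof.
move=> we we'; rewrite [RHS](innerZl _ (step_set_Lfun2 we) (step_fun_Lfun2 we')).
rewrite (innerZr _ (step_set_Lfun2 we) (step_set_Lfun2 we')).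
rewrite inner_indic; [|exact: step_set_measurable..].
rewrite [X in fine X](step_setI_measure we we').
case: we we' => a0 ab fB [a0' ab' fB'].
have b0 := le_trans a0 ab; have b0' := le_trans a0' ab'.
rewrite lebesgue_measure_ocitvI//.
have W2 t A : 0 <= t -> finite_borel A -> (W t A : T -> R) \in Lfun P 2%:E.
  exact: white_noise_Lfun2.
rewrite /step_int innerZl ?innerZr ?Lfun2Z ?Lfun2B ?W2//.
rewrite innerBl ?innerBr ?Lfun2B ?W2// !inner_white_noise//.
rewrite fineM//=; first by ring.
case: fB fB' => mA Aoo [mB Boo]; rewrite ge0_fin_numE//; apply: le_lt_trans Aoo.
by apply: le_measure; rewrite ?inE//; exact: measurableI.
Qed.

Lemma wiener_integral_Lfun2 h X : wiener_integral W h X ->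
  (X : T -> R) \in Lfun P 2%:E.
Proof.
move=> [_ [m [e [we _ cX]]]].
(* A sequence of extended reals tending to 0 is eventually finite, so some step sum [S] lies at
   finite L^2 distance from [X]; then [X = (X - S) + S] is in L^2. *)
have [n _ Sn] := cvg_is_fine cX.
pose S w := \sum_(i < m n) step_int W (e n i) w.
have hS : S \in Lfun P 2%:E by apply: Lfun2_sum => i; exact: step_int_Lfun2.
have -> : (X : T -> R) = fun w => (X w - S w) + S w.
  by apply/funext => w; rewrite subrK.
apply: Lfun2D => //; rewrite inE; apply/andP; split.
  rewrite inE; apply: measurable_funB => //; exact: Lfun2_measurable hS.
by rewrite inE/= /finite_norm -ge0_fin_numE ?Lnorm_ge0//; exact: (Sn n (leqnn n)).
Qed.

Lemma wiener_isometry h h' X X' :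
  wiener_integral W h X -> wiener_integral W h' X' ->
  inner P X X' = inner lambda2 h h'.
Proof.
move=> wX wX'; have hX := wiener_integral_Lfun2 wX.
have hX' := wiener_integral_Lfun2 wX'.
case: wX wX' => hh [m [e [we ch cX]]] [hh' [m' [e' [we' ch' cX']]]].
have c1 := cvg_inner hX hX'
  (fun n => Lfun2_sum _ (fun i => step_int_Lfun2 (we n i)))
  (fun n => Lfun2_sum _ (fun i => step_int_Lfun2 (we' n i))) cX cX'.
have c2 := cvg_inner hh hh'
  (fun n => Lfun2_sum _ (fun i => step_fun_Lfun2 (we n i)))
  (fun n => Lfun2_sum _ (fun i => step_fun_Lfun2 (we' n i))) ch ch'.
(* The approximating inner products under [P] and under [lambda2] are equal for each [n], by
   bilinearity and [inner_step], so their limits agree. *)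
apply: (cvg_unique (@norm_hausdorff _ _) c1).
apply: cvg_trans c2; apply: near_eq_cvg; apply: nearW => n /=; symmetry.
rewrite inner_suml; last 2 first.
- by move=> i; exact: step_int_Lfun2.
- by apply: Lfun2_sum => i; exact: step_int_Lfun2.
rewrite inner_suml; last 2 first.
- by move=> i; exact: step_fun_Lfun2.
- by apply: Lfun2_sum => i; exact: step_fun_Lfun2.
apply: eq_bigr => i _; rewrite !inner_sumr.
- by apply: eq_bigr => j _; exact: inner_step.
- by move=> j; exact: step_fun_Lfun2.
- exact: step_fun_Lfun2.
- by move=> j; exact: step_int_Lfun2.
- exact: step_int_Lfun2.
Qed.

End WienerIsometry.

(** * Inner products of wave kernels *)

Section WaveKernel.
Context (R : realType).

Local Notation lambda := (@lebesgue_measure R).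
Local Notation lambda2 := (lambda \x lambda)%E.

(** Convertible with the integrand of [mild_solution], so that facts about the latter apply as they
    stand. *)
Definition wave_kernel (t x : R) (p : measurableTypeR R * measurableTypeR R) : R :=
  \1_`[0, t] p.1 * G1 (t - p.1) (x - p.2).

(* Time of the apex of the intersection of the backward light cones of two
   points at times [t] and [s], at spatial distance [D]. *)
Definition cone_height (t s D : R) : R :=
  Num.min (Num.min t s) ((t + s - D) / 2).

(** The two kernel values 1/2 contribute a factor 1/4 to the length of the common section of the
    cones; [Num.max] covers the case where the section is empty. *)
Lemma wave_kernel_section (t s x y r : R) : 0 <= r -> r <= t -> r <= s ->
  (\int[lambda]_z (wave_kernel t x (r, z) * wave_kernel s y (r, z))%:E =
   (Num.max 0 ((cone_height t s `|x - y| - r) / 2))%:E)%E.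
Proof.
move=> r0 rt rs.
pose lo : R := Num.max (x - (t - r)) (y - (s - r)).
pose hi : R := Num.min (x + (t - r)) (y + (s - r)).
transitivity (\int[lambda]_z (4^-1%:E * (\1_(`]lo, hi[) z)%:E))%E.
  apply: eq_integral => z _; rewrite -EFinM; congr (_%:E).
  rewrite /wave_kernel /G1 !indicE/= !mem_setE !in_itv/= r0 rt rs !mul1r.
  have -> : (lo < z < hi) = (`|x - z| < t - r) && (`|y - z| < s - r).
    rewrite gt_max lt_min !ltr_norml; apply/idP/idP.
      by move=> /andP[/andP[h1 h2] /andP[h3 h4]]; apply/andP; split; lra.
    by move=> /andP[/andP[h1 h2] /andP[h3 h4]]; apply/andP; split; lra.
  by case: (_ < t - r); case: (_ < s - r); rewrite /=; lra.
rewrite ge0_integralZl//; last first.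
  by apply/measurable_EFinP; apply: measurable_indic; exact: measurable_itv.
rewrite integral_indic// setIT/= lebesgue_measure_itv/= lte_fin.
suff -> : (if (lo < hi)%R then hi%:E - lo%:E else 0%:E)%E =
    (Num.max 0 (2 * (cone_height t s `|x - y| - r)))%:E :> \bar R.
  by rewrite -EFinM; congr (_%:E); rewrite !maxEle; do 2 case: ifP; lra.
(* An upper end minus a lower end is 2(t - r), 2(s - r) or t + s - 2r plus or minus (x - y);
   [hi - lo] is the least of these. *)
have -> : 2 * (cone_height t s `|x - y| - r) = hi - lo.
  rewrite /cone_height /hi /lo !minEle !maxEle.
  by case: (ler0P (x - y)); repeat case: ifP; lra.
rewrite maxEle subr_ge0 -EFinB.
by case: ltgtP => // ->; rewrite subrr.
Qed.

Lemma half_square_integral (c : R) : 0 < c ->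
  (\int[lambda]_(r in `[0%R, c]) ((c - r) / 2)%:E = (c ^+ 2 / 4)%:E)%E.
Proof.
move=> c0.
(* The antiderivative of (c - r) / 2 that vanishes at 0. *)
pose F (r : R) := c / 2 * r - r ^+ 2 / 4 : R.
have dF (r : R) : is_derive r 1 F ((c - r) / 2).
  rewrite /F; apply: is_derive_eq; rewrite /GRing.scale/=; by lra.
have cF : continuous F.
  by move=> r; apply: differentiable_continuous; apply/derivable1_diffP; case: (dF r).
rewrite (@continuous_FTC2 _ _ F)//.
- by rewrite /F -EFinB; congr (_%:E); field.
- apply: continuous_subspaceT => r.
  by apply: cvgM; [apply: cvgB; [exact: cvg_cst|exact: cvg_id]|exact: cvg_cst].
- split.
  + by move=> r _; case: (dF r).
  + exact/cvg_at_right_filter/cF.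
  + exact/cvg_at_left_filter/cF.
- by move=> r _; rewrite derive1E derive_val.
Qed.

(** Tonelli's theorem reduces the integral to the sections at fixed time. Positivity of the height
    matters: at negative height the cones do not meet after time 0, and the inner product is 0
    instead of the square. *)
Lemma inner_wave_kernel (t s x y : R) : 0 <= t -> 0 <= s ->
  wave_kernel t x \in Lfun lambda2 2%:E -> wave_kernel s y \in Lfun lambda2 2%:E ->
  0 < cone_height t s `|x - y| ->
  inner lambda2 (wave_kernel t x) (wave_kernel s y) =
    cone_height t s `|x - y| ^+ 2 / 4.
Proof.
move=> t0 s0 ht hs c0; rewrite /inner /Rintegral.
set c := cone_height _ _ _ in c0 *.
have mh : measurable_fun setT
    (fun p => (wave_kernel t x p * wave_kernel s y p)%:E).
  apply/measurable_EFinP; apply: measurable_funM.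
    exact: Lfun2_measurable ht.
  exact: Lfun2_measurable hs.
have k0 (t' x' : R) p : 0 <= wave_kernel t' x' p.
  by rewrite /wave_kernel /G1 mulr_ge0// mulr_ge0.
rewrite fubini_tonelli1//=; last by move=> p; rewrite lee_fin mulr_ge0.
rewrite -[RHS]/(fine (c ^+ 2 / 4)%:E) -half_square_integral//; congr fine.
rewrite [RHS]integral_mkcond; apply: eq_integral => r _.
rewrite /fubini_F patchE mem_setE in_itv/=.
have [/andP[r0 rc]|rNc] := ifPn.
  have [rt rs] : r <= t /\ r <= s.
    by move: rc; rewrite /c /cone_height !le_min => /andP[/andP[]].
  by rewrite wave_kernel_section// (max_idPr _)// divr_ge0// subr_ge0.
(* Outside [0, c] the section integral vanishes: either [r] lies above the apex but below both
   times, and the truncation gives 0, or a time indicator is 0. *)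
have [/and3P[r0 rt rs]|out] := boolP [&& 0 <= r, r <= t & r <= s].
  rewrite wave_kernel_section// (max_idPl _)//.
  by move: rNc; rewrite r0/= -ltNge -/c => rc; lra.
apply: integral0_eq => z _; rewrite /wave_kernel !indicE/= !mem_setE !in_itv/=.
by move: out; case: (0 <= r); case: (r <= t); case: (r <= s); rewrite /= ?mul0r ?mulr0.
Qed.

End WaveKernel.

(** * Second differences of the covariance *)

Section WaveCovariance.
Context (R : realType).
Implicit Types t s D e : R.

(** The square is not truncated: for D > t + s it is positive although the cones no longer meet, so
    it is used as a covariance only for D < t + s. *)
Definition wave_cov t s D : R := cone_height t s D ^+ 2 / 4.

(** Since t + s = 2 min(t, s) + |t - s|, the term (t + s - D) / 2 is at least min(t, s) exactly when
    D <= |t - s|. At equality this formula and that of [wave_cov_far] agree, so both hypotheses may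
    be non-strict. *)
Lemma wave_cov_near t s D : D <= `|t - s| ->
  wave_cov t s D = Num.min t s ^+ 2 / 4.
Proof.
move=> Dts; rewrite /wave_cov /cone_height (min_idPl _)//.
by rewrite minEle; case: ifP; case: (ler0P (t - s)) Dts; lra.
Qed.

Lemma wave_cov_far t s D : `|t - s| <= D ->
  wave_cov t s D = (t + s - D) ^+ 2 / 16.
Proof.
move=> Dts; rewrite /wave_cov /cone_height (min_idPr _).
  by field.
by rewrite minEle; case: ifP; case: (ler0P (t - s)) Dts; lra.
Qed.

(* Covariance of two increments over intervals of length [e] whose left ends
   differ by [D]. *)
Definition increment_cov t s D e : R :=
  2 * wave_cov t s `|D| - wave_cov t s `|D + e| - wave_cov t s `|D - e|.

Lemma increment_covN t s D e : increment_cov t s (- D) e = increment_cov t s D e.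
Proof.
rewrite /increment_cov normrN -(normrN (D + e)) -(normrN (D - e)) !opprD opprK.
by rewrite addrAC.
Qed.

(** All three distances are in the quadratic regime, and the second difference of D^2 / 16 with step
    e is e^2 / 8. *)
Lemma increment_cov_far t s D e : 0 < e -> `|t - s| <= D - e ->
  increment_cov t s D e = - (e ^+ 2 / 8).
Proof.
move=> e0 h; have h0 := le_trans (normr_ge0 _) h.
rewrite /increment_cov !ger0_norm; [|lra..].
rewrite !wave_cov_far; [|lra..].
by field.
Qed.

(** Only D - e is in the constant regime; [e <= D] lets the absolute values be dropped. *)
Lemma increment_cov_mid1 t s D e : 0 < e -> e <= D -> D - e <= `|t - s| <= D ->
  increment_cov t s D e = 2 / 16 * (t + s - D) ^+ 2
    - 1 / 16 * (t + s - (D + e)) ^+ 2 - 1 / 4 * Num.min t s ^+ 2.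
Proof.
move=> e0 eD /andP[h1 h2].
rewrite /increment_cov !ger0_norm; [|lra..].
rewrite (wave_cov_near h1) !wave_cov_far; [|lra..].
by field.
Qed.

(** Now D - e and D are in the constant regime, and only D + e is in the quadratic one. *)
Lemma increment_cov_mid2 t s D e : 0 < e -> e <= D -> D <= `|t - s| <= D + e ->
  increment_cov t s D e =
    1 / 4 * Num.min t s ^+ 2 - 1 / 16 * (t + s - (D + e)) ^+ 2.
Proof.
move=> e0 eD /andP[h1 h2].
rewrite /increment_cov !ger0_norm; [|lra..].
rewrite (wave_cov_far h2) !wave_cov_near; [|lra..].
by field.
Qed.

(** All three distances are in the constant regime. D = 0 is allowed, as increments over the same
    interval require. *)
Lemma increment_cov_near t s D e : 0 < e -> `|D| + e <= `|t - s| ->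
  increment_cov t s D e = 0.
Proof.
move=> e0 h; rewrite /increment_cov.
have h1 := ler_normD D e; have h2 := ler_normB D e; have ee := gtr0_norm e0.
rewrite !wave_cov_near; [|lra..].
by field.
Qed.

End WaveCovariance.

(** * Covariances of the solution and of its increments *)

Section SolutionIncrements.
Context (R : realType) (d : measure_display) (T : measurableType d)
  (P : probability T R) (W : R -> set (measurableTypeR R) -> {RV P >-> R})
  (u : R -> R -> {RV P >-> R}).
Hypotheses (hW : white_noise W) (hu : mild_solution W u).

Lemma expectation_inner (X Y : T -> R) :
  X \in Lfun P 2%:E -> Y \in Lfun P 2%:E ->
  ('E_P[fun w => (X w * Y w)%R] = (inner P X Y)%:E)%E.
Proof.
move=> hX hY; rewrite unlock /inner /Rintegral fineK//.
by apply: integrable_fin_num => //; exact: inner_integrable.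
Qed.

Lemma mild_solution_Lfun2 t x : 0 <= t -> (u t x : T -> R) \in Lfun P 2%:E.
Proof. by move=> t0; exact: wiener_integral_Lfun2 (hu x t0). Qed.

Lemma mild_solution_cov t s x y : 0 < t -> 0 < s -> `|x - y| < t + s ->
  inner P (u t x) (u s y) = wave_cov t s `|x - y|.
Proof.
move=> t0 s0 xy; rewrite (wiener_isometry hW (hu x (ltW t0)) (hu y (ltW s0))).
have [ht _] := hu x (ltW t0); have [hs _] := hu y (ltW s0).
apply: inner_wave_kernel (ltW t0) (ltW s0) ht hs _.
by rewrite /cone_height !lt_min t0 s0 /= divr_gt0// subr_gt0.
Qed.

Lemma increment_expectation N (i j : 'I_N) (t s : R) : 0 < t -> 0 < s -> 1 < t + s ->
  ('E_P[fun w => (increment u N t i w * increment u N s j w)%R] =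
   (increment_cov t s ((i%:R - j%:R) / N%:R) N%:R^-1)%:E)%E.
Proof.
move=> t0 s0 ts; have N0 : 0 < N%:R :> R by rewrite ltr0n (leq_ltn_trans _ (ltn_ord i)).
have u2 t' x : 0 < t' -> (u t' x : T -> R) \in Lfun P 2%:E.
  by move=> /ltW; exact: mild_solution_Lfun2.
have i2 k t' : 0 < t' -> increment u N t' k \in Lfun P 2%:E.
  by move=> t'0; apply: Lfun2B; exact: u2.
(* All end points lie in [0, 1], so their distances are at most 1 < t + s and [mild_solution_cov]
   applies to each of the four pairs. *)
have itv (k : 'I_N) (k' : nat) : (k' = k \/ k' = k.+1)%N -> 0 <= (k'%:R / N%:R : R) <= 1.
  move=> hk; rewrite divr_ge0//= ler_pdivrMr// mul1r ler_nat.
  by case: hk => ->; rewrite // ltnW.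
have cov (k l : nat) : (k = i \/ k = i.+1)%N -> (l = j \/ l = j.+1)%N ->
    inner P (u t (k%:R / N%:R)) (u s (l%:R / N%:R)) =
    wave_cov t s `|(k%:R - l%:R) / N%:R|.
  move=> /itv hk /itv hl; rewrite mild_solution_cov//; first by rewrite mulrBl.
  by apply: le_lt_trans ts; rewrite ler_norml; lra.
rewrite expectation_inner ?i2//; congr (_%:E).
rewrite innerBl ?innerBr ?u2 ?i2// ?Lfun2B ?u2//.
rewrite !cov; [|by [left|right]..].
rewrite /increment_cov -(natr1 i) -(natr1 j) !mulrBl !mulrDl mul1r.
set a := _ / _; set b := _ / _; set e := N%:R^-1.
have -> : a + e - (b + e) = a - b by ring.
have -> : a + e - b = a - b + e by ring.
have -> : a - (b + e) = a - b - e by ring.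
by ring.
Qed.

(** [increment_cov] is even in D, so the signed index difference may be replaced by its absolute
    value. *)
Lemma increment_expectation_dist N (i j : 'I_N) (t s : R) : 0 < t -> 0 < s -> 1 < t + s ->
  ('E_P[fun w => (increment u N t i w * increment u N s j w)%R] =
   (increment_cov t s (`|(i : nat)%:Z - (j : nat)%:Z|%N%:R / N%:R) N%:R^-1)%:E)%E.
Proof.
move=> t0 s0 ts; rewrite increment_expectation//; congr (_%:E).
have -> : `|(i : nat)%:Z - (j : nat)%:Z|%N%:R = `|i%:R - j%:R| :> R.
  by rewrite natr_absz intr_norm rmorphB.
by case: (ler0P (i%:R - j%:R : R)) => // _; rewrite mulNr increment_covN.
Qed.

End SolutionIncrements.

(** * The four covariance formulas *)

Theorem lemma8 (R : realType) (d : measure_display) (T : measurableType d)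
  (P : probability T R) (W : R -> set (measurableTypeR R) -> {RV P >-> R})
  (u : R -> R -> {RV P >-> R})
  (hW : white_noise W) (hu : mild_solution W u) :
  [/\ (* (a) *)
      forall t1 t2 : R, 0 < t1 -> 0 < t2 -> t1 != t2 -> 1 < t1 + t2 ->
      forall (N : nat) (i j : 'I_N), i != j ->
        let k := `|(i : nat)%:Z - (j : nat)%:Z|%N in
        'E_P[fun w => (increment u N t1 i w * increment u N t2 j w)%R]%E =
        (- (1 / (8 * N%:R ^+ 2)) * (`|t1 - t2| <= (k%:R - 1) / N%:R)%R%:R
         + f1 t1 t2 N k *
             ((k%:R - 1) / N%:R < `|t1 - t2| <= k%:R / N%:R)%R%:R
         + f2 t1 t2 N k *
             (k%:R / N%:R < `|t1 - t2| <= (k%:R + 1) / N%:R)%R%:R)%:E,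
      (* (b) *)
      forall t1 t2 : R, 0 < t1 -> 0 < t2 -> t1 != t2 -> 1 < t1 + t2 ->
      forall N : nat, `|t1 - t2|^-1 < N%:R -> forall i : 'I_N,
        'E_P[fun w => (increment u N t1 i w * increment u N t2 i w)%R]%E = 0%E,
      (* (c) *)
      forall t : R, 1 / 2 < t -> forall (N : nat) (i : 'I_N),
        'E_P[fun w => (increment u N t i w ^+ 2)%R]%E =
          (1 / (4 * N%:R) * (2 * t) - 1 / (8 * N%:R ^+ 2))%:E /\
        1 / (4 * N%:R) * (2 * t) - 1 / (8 * N%:R ^+ 2) =
          1 / (4 * N%:R) * (2 * t - 1 / (2 * N%:R)) &
      (* (d) *)
      forall t : R, 1 / 2 < t -> forall (N : nat) (i j : 'I_N), i != j ->
        'E_P[fun w => (increment u N t i w * increment u N t j w)%R]%E =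
          (- (1 / (8 * N%:R ^+ 2)))%:E].
Proof.
(* Distinct indices differ by at least 1, which is the condition [e <= D]. *)
have dist_ge1 N (i j : 'I_N) : i != j ->
    N%:R^-1 <= `|(i : nat)%:Z - (j : nat)%:Z|%N%:R / N%:R :> R.
  move=> ij; rewrite ler_peMl ?invr_ge0// ler1n absz_gt0 subr_eq0.
  by apply: contra ij => /eqP[]/val_inj ->.
split.
- move=> t1 t2 t10 t20 t12 ts N i j ij k.
  have N0 : 0 < N%:R :> R by rewrite ltr0n (leq_ltn_trans _ (ltn_ord i)).
  rewrite (increment_expectation_dist hW hu)// -/k; congr (_%:E).
  have eD : N%:R^-1 <= k%:R / N%:R :> R := dist_ge1 N i j ij.
  have e0 : 0 < N%:R^-1 :> R by rewrite invr_gt0.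
  rewrite /f1 /f2 -(natr1 k) (mulrBl _ k%:R) (mulrDl k%:R) (mul1r N%:R^-1).
  have -> : 1 / (8 * N%:R ^+ 2) = N%:R^-1 ^+ 2 / 8 :> R by field; exact: lt0r_neq0.
  set D := _ / _ in eD *; set e := N%:R^-1 in eD e0 *.
  (* Four positions of |t1 - t2| relative to D - e < D < D + e remain; the last one, beyond D + e,
     makes every indicator and the covariance vanish. *)
  case: (leP `|t1 - t2| (D - e)) => h1; case: (leP `|t1 - t2| D) => h2;
    case: (leP `|t1 - t2| (D + e)) => h3 /=;
    rewrite ?mulr1 ?mulr0 ?add0r ?addr0; try (by exfalso; lra).
  - exact: increment_cov_far.
  - by rewrite increment_cov_mid1// ltW// ltW.
  - by rewrite increment_cov_mid2// ltW.
  - by rewrite increment_cov_near// ger0_norm; lra.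
- move=> t1 t2 t10 t20 t12 ts N hN i.
  have N0 : 0 < N%:R :> R by rewrite ltr0n (leq_ltn_trans _ (ltn_ord i)).
  rewrite (increment_expectation hW hu)// increment_cov_near ?invr_gt0//.
  (* Here D = 0, and 1/N <= |t1 - t2| is the bound on [N] after taking inverses. *)
  rewrite subrr mul0r normr0 add0r -[leRHS]invrK lef_pV2 ?posrE ?invr_gt0//.
    exact: ltW.
  by rewrite normr_gt0 subr_eq0.
- move=> t ht N i.
  have N0 : 0 < N%:R :> R by rewrite ltr0n (leq_ltn_trans _ (ltn_ord i)).
  have t0 : 0 < t by lra.
  split; last by field; exact: lt0r_neq0.
  have -> : (fun w => increment u N t i w ^+ 2) =
      (fun w => increment u N t i w * increment u N t i w).
    by apply/funext => w; rewrite expr2.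
  rewrite (increment_expectation hW hu)//; last by lra.
  have e0 : 0 < N%:R^-1 :> R by rewrite invr_gt0.
  (* With D = 0 and e = 1/N the covariance is 2 t^2 / 4 - 2 (2t - e)^2 / 16 = t e / 2 - e^2 / 8. *)
  rewrite subrr mul0r /increment_cov add0r sub0r normrN normr0 gtr0_norm//.
  rewrite (wave_cov_near (normr_ge0 _)) wave_cov_far; last first.
    by rewrite subrr normr0 ltW.
  by rewrite minxx; congr (_%:E); field; exact: lt0r_neq0.
- move=> t ht N i j ij.
  have N0 : 0 < N%:R :> R by rewrite ltr0n (leq_ltn_trans _ (ltn_ord i)).
  have t0 : 0 < t by lra.
  rewrite (increment_expectation_dist hW hu)//; last by lra.
  (* Equal times give |t - s| = 0 <= D - e, so distinct intervals are always in the quadratic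
     regime. *)
  rewrite increment_cov_far ?invr_gt0//; last first.
    by rewrite subrr normr0 subr_ge0 dist_ge1.
  by congr (_%:E); field; exact: lt0r_neq0.
Qed.
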